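(* Let $R$ be a ring with unity. The category of finitely presented graded $R[t]$-modules is isomorphic to the category of discrete algebraic persistence modules over $R$ of finitely presented type.
   Context: $\mathbb{N}=\{0,1,2,\dots\}$. Rings have a unity and need not be commutative; modules are left modules. $R[t]$ is graded over $\mathbb{N}$ with $R[t]_i$ the $R$-module generated by $t^i$ (and $t$ commutes with the elements of $R$). A graded $R[t]$-module is an $R[t]$-module $M$ with a decomposition $M=\bigoplus_{i\in\mathbb{N}}M_i$ into abelian groups such that $s\cdot m\in M_{i+j}$ for $s\in R[t]_i$, $m\in M_j$. A graded morphism $f:M\to N$ is an $R[t]$-module morphism with $f(M_i)\subseteq N_i$ for all $i$. An $R$-module $M$ is finitely presented if there is an exact sequence $R^m\to R^n\to M\to 0$ with $m,n\in\mathbb{N}$ (similarly over $R[t]$). A discrete algebraic persistence module (DAPM) over $R$ is a tuple $\mathcal{M}=((M_i)_{i\in\mathbb{N}},(\varphi_{i,j})_{i\le j\in\mathbb{N}})$ where each $M_i$ is an $R$-module, each $\varphi_{i,j}:M_i\to M_j$ is an $R$-module morphism, $\varphi_{i,i}=1_{M_i}$, and $\varphi_{i,k}=\varphi_{j,k}\circ\varphi_{i,j}$ for all $i\le j\le k$. A morphism of DAPMs from $((M_i),(\varphi_{i,j}))$ to $((N_i),(\psi_{i,j}))$ is a family $(\xi_i:M_i\to N_i)_{i\in\mathbb{N}}$ of $R$-module morphisms with $\psi_{i,j}\circ\xi_i=\xi_j\circ\varphi_{i,j}$ for all $i\le j$. A DAPM is of finite type if there is $D\in\mathbb{N}$ such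 that $\varphi_{i,j}$ is an isomorphism for all $D\le i\le j$. It is of finitely presented type if it is of finite type and every $M_i$ is finitely presented as an $R$-module. The two categories in the claim are the full subcategories, on the indicated objects, of the category of graded $R[t]$-modules with graded morphisms and of the category of DAPMs over $R$ with DAPM morphisms. Two categories $\mathbf{C},\mathbf{D}$ are isomorphic if there are functors $F:\mathbf{C}\to\mathbf{D}$ and $G:\mathbf{D}\to\mathbf{C}$ such that $F\circ G$ and $G\circ F$ are the identity functors. *)

(* Defs.v *)
(* Rings are pzRingType, possibly zero and not necessarily commutative. Since
   {poly R} requires 1 != 0 in R, the ring R[t] is constructed below as a
   direct sum with the convolution product. Direct sums get their eqType and
   choiceType structures from classical choice. *)
From HB Require Import structures.
From mathcomp Require Import all_boot all_algebra.
From mathcomp Require Import boolp.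

Set Implicit Arguments.
Unset Strict Implicit.
Unset Printing Implicit Defensive.

Import GRing.Theory.
Local Open Scope ring_scope.
#[local] Obligation Tactic := idtac.

Record category := Category {
  obj : Type;
  hom : obj -> obj -> Type;
  idm : forall X, hom X X;
  cmp : forall X Y Z, hom Y Z -> hom X Y -> hom X Z;
  cmp1m : forall X Y (f : hom X Y), cmp (idm Y) f = f;
  cmpm1 : forall X Y (f : hom X Y), cmp f (idm X) = f;
  cmpA : forall X Y Z W (h : hom Z W) (g : hom Y Z) (f : hom X Y),
    cmp h (cmp g f) = cmp (cmp h g) f
}.

Record functor (C D : category) := Functor {
  fobj : obj C -> obj D;
  fmap : forall X Y, hom X Y -> hom (fobj X) (fobj Y);
  fmap_id : forall X, fmap (idm X) = idm (fobj X);
  fmap_cmp : forall X Y Z (g : hom Y Z) (f : hom X Y),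
    fmap (cmp g f) = cmp (fmap g) (fmap f)
}.

Definition functor_id (C : category) : functor C C :=
  @Functor C C (fun X => X) (fun _ _ f => f)
    (fun _ => erefl) (fun _ _ _ _ _ => erefl).

Program Definition functor_comp (C D E : category)
    (G : functor D E) (F : functor C D) : functor C E :=
  @Functor C E (fun X => fobj G (fobj F X)) (fun _ _ f => fmap G (fmap F f)) _ _.
Next Obligation. by move=> *; rewrite /= !fmap_id. Qed.
Next Obligation. by move=> *; rewrite /= !fmap_cmp. Qed.

(* Isomorphism, not equivalence: the composites are equal to the identity
   functors, on objects as well as on morphisms. *)
Definition cat_isomorphic (C D : category) : Prop :=
  exists (F : functor C D) (G : functor D C),
    functor_comp F G = functor_id D /\ functor_comp G F = functor_id C.

Program Definition full_subcategory (C : category) (P : obj C -> Prop) :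
    category :=
  @Category {X : obj C | P X} (fun X Y => hom (sval X) (sval Y))
    (fun X => idm (sval X)) (fun _ _ _ g f => cmp g f) _ _ _.
Next Obligation. by move=> *; exact: cmp1m. Qed.
Next Obligation. by move=> *; exact: cmpm1. Qed.
Next Obligation. by move=> *; exact: cmpA. Qed.

(* The vectors of S^n are rows, on which S acts by left multiplication. *)
Definition finitely_presented (S : pzRingType) (V : lmodType S) : Prop :=
  exists (m n : nat)
         (g : {linear 'rV[S]_m -> 'rV[S]_n}) (h : {linear 'rV[S]_n -> V}),
    (forall u, h u = 0 <-> exists w, g w = u) /\ (forall v, exists u, h u = v).

Definition linear_iso (S : pzRingType) (U V : lmodType S)
    (f : {linear U -> V}) : Prop :=
  exists g : {linear V -> U}, cancel f g /\ cancel g f.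

Lemma linear_ext (S : pzRingType) (U V : lmodType S) (f g : {linear U -> V}) :
  f =1 g -> f = g.
Proof.
case: f g => [f [[[f0 fD]] [fZ]]] [g [[[g0 gD]] [gZ]]] /= fg.
have {}fg : f = g by apply: funext.
subst g; by rewrite (Prop_irrelevance f0 g0) (Prop_irrelevance fD gD)
  (Prop_irrelevance fZ gZ).
Qed.

Record dsum (M : nat -> zmodType) := DSum {
  dcoef :> forall i, M i;
  dcoef_fin : exists n : nat, forall i, (n <= i)%N -> dcoef i = 0
}.

Section DSum.
Variable M : nat -> zmodType.
Implicit Types m : dsum M.

Lemma dsumP m1 m2 : (forall i, m1 i = m2 i) -> m1 = m2.
Proof.
case: m1 m2 => [f Hf] [g Hg] /= fg.
have {}fg : f = g by apply: functional_extensionality_dep.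
by subst g; rewrite (Prop_irrelevance Hf Hg).
Qed.

Program Definition dsum0 : dsum M := @DSum M (fun=> 0) _.
Next Obligation. by exists 0%N. Qed.

Program Definition dsum_opp m : dsum M := @DSum M (fun i => - m i) _.
Next Obligation.
by move=> m; have [n mE] := dcoef_fin m; exists n => i /mE->; rewrite oppr0.
Qed.

Program Definition dsum_add m1 m2 : dsum M := @DSum M (fun i => m1 i + m2 i) _.
Next Obligation.
move=> m1 m2; have [n1 m1E] := dcoef_fin m1; have [n2 m2E] := dcoef_fin m2.
exists (maxn n1 n2) => i; rewrite geq_max => /andP[/m1E-> /m2E->].
by rewrite addr0.
Qed.

HB.instance Definition _ := gen_eqMixin (dsum M).
HB.instance Definition _ := gen_choiceMixin (dsum M).

Fact dsum_addA : associative dsum_add.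
Proof. by move=> x y z; apply: dsumP => i /=; rewrite addrA. Qed.
Fact dsum_addC : commutative dsum_add.
Proof. by move=> x y; apply: dsumP => i /=; rewrite addrC. Qed.
Fact dsum_add0 : left_id dsum0 dsum_add.
Proof. by move=> x; apply: dsumP => i /=; rewrite add0r. Qed.
Fact dsum_addN : left_inverse dsum0 dsum_opp dsum_add.
Proof. by move=> x; apply: dsumP => i /=; rewrite addNr. Qed.

HB.instance Definition _ := GRing.isZmodule.Build (dsum M)
  dsum_addA dsum_addC dsum_add0 dsum_addN.

(* m lies in the i-th summand of the direct sum. *)
Definition homogeneous (i : nat) m : Prop := forall k, k != i -> m k = 0.

End DSum.

(* R[t], a polynomial being its finitely supported sequence of coefficients *)
Definition tpoly (R : pzRingType) : Type := dsum (fun _ => R : zmodType).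

Section TPoly.
Variable R : pzRingType.
HB.instance Definition _ := GRing.Zmodule.on (tpoly R).
Implicit Types p q r : tpoly R.

Program Definition tpolyC (c : R) : tpoly R :=
  @DSum _ (fun i => if i == 0%N then c else 0) _.
Next Obligation. by move=> c; exists 1%N => -[]. Qed.

Program Definition tpolyX : tpoly R :=
  @DSum _ (fun i => if i == 1%N then 1 else 0) _.
Next Obligation. by exists 2%N => -[|[]]. Qed.

Program Definition tpoly_mul p q : tpoly R :=
  @DSum _ (fun k => \sum_(i < k.+1) (p i : R) * (q (k - i)%N : R)) _.
Next Obligation.
move=> p q; have [n1 pE] := dcoef_fin p; have [n2 qE] := dcoef_fin q.
exists (n1 + n2)%N => k le_n_k; rewrite big1 // => i _.
have [/pE->|lt_i_n1] := leqP n1 i; first by rewrite mul0r.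
rewrite qE ?mulr0 // leq_subRL; last by rewrite -ltnS.
by rewrite (leq_trans _ le_n_k) // leq_add2r ltnW.
Qed.

Fact coef_tpoly_mul p q k :
  tpoly_mul p q k = \sum_(i < k.+1) (p i : R) * (q (k - i)%N : R).
Proof. by []. Qed.

Fact coef_tpoly_mul_rev p q k :
  tpoly_mul p q k = \sum_(i < k.+1) (p (k - i)%N : R) * (q i : R).
Proof.
rewrite /= (reindex_inj rev_ord_inj) /=.
by apply: eq_bigr => j _; rewrite (sub_ordK j).
Qed.

Fact tpoly_mulA : associative tpoly_mul.
Proof.
move=> p q r; apply: dsumP => i; rewrite coef_tpoly_mul coef_tpoly_mul_rev.
pose coef3 j k : R := (p j : R) * ((q (i - j - k)%N : R) * (r k : R)).
transitivity (\sum_(j < i.+1) \sum_(k < i.+1 | (k <= i - j)%N) coef3 j k).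
  apply: eq_bigr => j _; rewrite coef_tpoly_mul_rev big_distrr /=.
  by rewrite (big_ord_narrow_leq (leq_subr _ _)).
rewrite (exchange_big_dep predT) //=; apply: eq_bigr => k _.
transitivity (\sum_(j < i.+1 | (j <= i - k)%N) coef3 j k).
  apply: eq_bigl => j; rewrite -ltnS -(ltnS j) -!subSn ?leq_ord //.
  by rewrite -subn_gt0 -(subn_gt0 j) -!subnDA addnC.
rewrite (big_ord_narrow_leq (leq_subr _ _)) big_distrl /=.
by apply: eq_bigr => j _; rewrite /coef3 -!subnDA addnC mulrA.
Qed.

Fact tpoly_mul1l : left_id (tpolyC 1) tpoly_mul.
Proof.
move=> p; apply: dsumP => i /=; rewrite big_ord_recl subn0 mul1r.
by rewrite big1 ?addr0 // => j _; rewrite mul0r.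
Qed.

Fact tpoly_mul1r : right_id (tpolyC 1) tpoly_mul.
Proof.
move=> p; apply: dsumP => i; rewrite coef_tpoly_mul_rev big_ord_recl subn0 mulr1.
by rewrite big1 ?addr0 // => j _; rewrite mulr0.
Qed.

Fact tpoly_mulDl : left_distributive tpoly_mul +%R.
Proof.
move=> p q r; apply: dsumP => i /=; rewrite -big_split.
by apply: eq_bigr => j _; rewrite mulrDl.
Qed.

Fact tpoly_mulDr : right_distributive tpoly_mul +%R.
Proof.
move=> p q r; apply: dsumP => i /=; rewrite -big_split.
by apply: eq_bigr => j _; rewrite mulrDr.
Qed.

HB.instance Definition _ := GRing.Zmodule_isPzRing.Build (tpoly R)
  tpoly_mulA tpoly_mul1l tpoly_mul1r tpoly_mulDl tpoly_mulDr.

(* s belongs to R[t]_i, the R-submodule of R[t] generated by t^i. *)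
Definition tpoly_homogeneous (i : nat) (s : tpoly R) : Prop :=
  exists c : R, s = tpolyC c * tpolyX ^+ i.

End TPoly.

(* A graded R[t]-module M = \bigoplus_i M_i. The decomposition is read as an
   equality, i.e. the underlying abelian group is the direct sum of the family
   (M_i)_i itself rather than a group isomorphic to it: otherwise M could not
   be recovered on the nose from (M_i)_i, and the category of graded modules
   would only be equivalent to a category of persistence modules. *)
Record graded_module (R : pzRingType) := GradedModule {
  gr_comp : nat -> zmodType;
  gr_scale : tpoly R -> dsum gr_comp -> dsum gr_comp;
  gr_scaleA : forall a b v, gr_scale a (gr_scale b v) = gr_scale (a * b) v;
  gr_scale1 : left_id 1 gr_scale;
  gr_scaleDr : right_distributive gr_scale +%R;
  gr_scaleDl : forall v, {morph gr_scale^~ v : a b / a + b};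
  gr_scale_homogeneous : forall i j s m,
    tpoly_homogeneous i s -> homogeneous j m ->
    homogeneous (i + j) (gr_scale s m)
}.

Definition gr_carrier (R : pzRingType) (M : graded_module R) : Type :=
  dsum (gr_comp M).
HB.instance Definition _ R (M : graded_module R) :=
  GRing.Zmodule.on (gr_carrier M).
HB.instance Definition _ R (M : graded_module R) :=
  GRing.Zmodule_isLmodule.Build (tpoly R) (gr_carrier M)
    (@gr_scaleA R M) (@gr_scale1 R M) (@gr_scaleDr R M) (@gr_scaleDl R M).

Record graded_hom (R : pzRingType) (M N : graded_module R) := GradedHom {
  gr_fun :> {linear gr_carrier M -> gr_carrier N};
  gr_fun_homogeneous : forall i (m : dsum (gr_comp M)),
    homogeneous i m -> homogeneous i (gr_fun m)
}.

Arguments gr_fun_homogeneous {R M N} g {i m} : rename.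

Lemma graded_hom_ext R (M N : graded_module R) (f g : graded_hom M N) :
  f =1 g -> f = g.
Proof.
case: f g => [f Hf] [g Hg] /= fg.
have {}fg : f = g by apply: linear_ext.
by subst g; rewrite (Prop_irrelevance Hf Hg).
Qed.

Definition graded_id R (M : graded_module R) : graded_hom M M :=
  @GradedHom R M M (@idfun (gr_carrier M)) (fun _ _ Hm => Hm).

Definition graded_cmp R (M N P : graded_module R)
    (g : graded_hom N P) (f : graded_hom M N) : graded_hom M P :=
  @GradedHom R M P (g \o f)
    (fun i m Hm => gr_fun_homogeneous g (gr_fun_homogeneous f Hm)).

Program Definition graded_cat (R : pzRingType) : category :=
  @Category (graded_module R) (@graded_hom R) (@graded_id R) (@graded_cmp R)
    _ _ _.
Next Obligation. by move=> *; apply: graded_hom_ext. Qed.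
Next Obligation. by move=> *; apply: graded_hom_ext. Qed.
Next Obligation. by move=> *; apply: graded_hom_ext. Qed.

Record dapm (R : pzRingType) := Dapm {
  pm_comp : nat -> lmodType R;
  pm_map : forall i j, (i <= j)%N -> {linear pm_comp i -> pm_comp j};
  pm_map_id : forall i (Hii : (i <= i)%N) x, pm_map Hii x = x;
  pm_map_cmp : forall i j k
      (Hij : (i <= j)%N) (Hjk : (j <= k)%N) (Hik : (i <= k)%N) x,
    pm_map Hik x = pm_map Hjk (pm_map Hij x)
}.

Record dapm_hom (R : pzRingType) (M N : dapm R) := DapmHom {
  pm_fun : forall i, {linear pm_comp M i -> pm_comp N i};
  pm_fun_nat : forall i j (Hij : (i <= j)%N) x,
    pm_map N Hij (pm_fun i x) = pm_fun j (pm_map M Hij x)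
}.

Lemma dapm_hom_ext R (M N : dapm R) (f g : dapm_hom M N) :
  (forall i, pm_fun f i =1 pm_fun g i) -> f = g.
Proof.
case: f g => [f Hf] [g Hg] /= fg.
have {}fg : f = g.
  by apply: functional_extensionality_dep => i; exact: (linear_ext (fg i)).
by subst g; rewrite (Prop_irrelevance Hf Hg).
Qed.

Definition dapm_id R (M : dapm R) : dapm_hom M M :=
  @DapmHom R M M (fun i => @idfun (pm_comp M i)) (fun _ _ _ _ => erefl).

Program Definition dapm_cmp R (M N P : dapm R)
    (g : dapm_hom N P) (f : dapm_hom M N) : dapm_hom M P :=
  @DapmHom R M P (fun i => pm_fun g i \o pm_fun f i) _.
Next Obligation.
move=> R M N P g f i j Hij x /=.
by rewrite (pm_fun_nat g Hij) (pm_fun_nat f Hij).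
Qed.

Program Definition dapm_cat (R : pzRingType) : category :=
  @Category (dapm R) (@dapm_hom R) (@dapm_id R) (@dapm_cmp R) _ _ _.
Next Obligation. by move=> *; apply: dapm_hom_ext. Qed.
Next Obligation. by move=> *; apply: dapm_hom_ext. Qed.
Next Obligation. by move=> *; apply: dapm_hom_ext. Qed.

Definition finite_type R (M : dapm R) : Prop :=
  exists D : nat, forall i j (Hij : (i <= j)%N),
    (D <= i)%N -> linear_iso (pm_map M Hij).

Definition finitely_presented_type R (M : dapm R) : Prop :=
  finite_type M /\ forall i, finitely_presented (pm_comp M i).

Definition fp_graded_cat (R : pzRingType) : category :=
  @full_subcategory (graded_cat R)
    (fun M : graded_module R => finitely_presented (gr_carrier M)).

Definition fp_dapm_cat (R : pzRingType) : category :=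
  @full_subcategory (dapm_cat R) (@finitely_presented_type R).

(* Main.v *)
From HB Require Import structures.
From mathcomp Require Import all_boot all_algebra.
From mathcomp Require Import boolp.
(* Loaded last, so that hom denotes the morphisms of a category. *)
Require Import Defs.

Set Implicit Arguments.
Unset Strict Implicit.
Unset Printing Implicit Defensive.

Import GRing.Theory.
Local Open Scope ring_scope.

(** A graded R[t]-module on the group M = (+)_i M_i amounts to R-module
    structures on the M_i (the action of degree 0) together with linear maps
    M_i -> M_(i+1) (multiplication by t): every action is the sum of its values
    on monomials and homogeneous elements ([gr_scale_coef]). In the same way a
    graded morphism is the sum of its restrictions to the components
    ([gr_fun_coef]). Hence M |-> (+)_i M_i, [graded_functor], is bijective on
    objects and on morphisms, and such a functor has an inverse
    ([bijective_functor_isomorphic]). It remains to see that it matches the two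
    finiteness conditions.

    Suppose that M = (+)_i M_i has generators g_a and relators r_l over R[t],
    homogeneous or not.
    - M_i is finitely presented ([comp_finitely_presented]). The elements
      (t^j g_a)_i with j <= i generate it. Write t^j g_a - (t^j g_a)_i as a
      combination w_(a,j) of the g_b. If sum c_(a,j) (t^j g_a)_i = 0, then
      sum c_(a,j) (t^j e_a - w_(a,j)) is a relation between the g_b, hence a
      combination of the r_l. Reading coefficients of degree at most i, one
      sees that the truncations of the w_(a,j) and of the t^j r_l are relators
      of M_i.
    - M_i -> M_j is onto for large i, because the g_a have bounded degree
      ([shift_surj]).
    - M_i -> M_(i+1) is injective for large i ([shift_inj_step]). If t x = 0
      and x = sum p_a g_a, then t p = sum q_l r_l. Subtracting from p the
      relation sum ((q_l - q_l(0)) / t) r_l leaves a vector s with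
      t s = sum q_l(0) r_l, of bounded degree; so the degree of
      x = sum s_a g_a is bounded as well.

    Conversely let M_i be stable from D on, with finite presentations of all
    M_i. The generators of M_0, ..., M_D generate M over R[t], and two kinds of
    relators suffice: those of M_0, ..., M_D, and the expressions of t g, for g
    a generator of M_i with i < D, in the generators of M_(i+1). Indeed, modulo
    the latter every vector of degree n is t^(n-i) times a combination of the
    generators of M_i, i = min(n, D). If its value in M_n is zero, so is the
    combination in M_i, as M_i -> M_n is injective, and then it is a consequence
    of the relators of M_i ([lifts_ker]). *)

(** * Bijective functors *)

Section BijectiveFunctors.

Definition hom_cast (C : category) (X X' Y Y' : obj C)
    (eX : X = X') (eY : Y = Y') (f : hom X Y) : hom X' Y' :=
  ecast Z (hom X' Z) eY (ecast Z (hom Z Y) eX f).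

Lemma hom_cast_id (C : category) (X Y : obj C) (eX : X = X) (eY : Y = Y)
  (f : hom X Y) : hom_cast eX eY f = f.
Proof. by rewrite (Prop_irrelevance eX erefl) (Prop_irrelevance eY erefl). Qed.

Lemma hom_cast_trans (C : category) (X X' X'' Y Y' Y'' : obj C)
    (eX : X = X') (eX' : X' = X'') (eY : Y = Y') (eY' : Y' = Y'')
    (f : hom X Y) :
  hom_cast eX' eY' (hom_cast eX eY f) =
  hom_cast (etrans eX eX') (etrans eY eY') f.
Proof. by move: eX eX' eY eY'; do 4!case: _ /. Qed.

Lemma hom_cast_idm (C : category) (X X' : obj C) (e : X = X') :
  hom_cast e e (idm X) = idm X'.
Proof. by case: _ / e. Qed.

Lemma hom_cast_cmp (C : category) (X X' Y Y' Z Z' : obj C)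
    (eX : X = X') (eY : Y = Y') (eZ : Z = Z') (g : hom Y Z) (f : hom X Y) :
  hom_cast eX eZ (cmp g f) = cmp (hom_cast eY eZ g) (hom_cast eX eY f).
Proof. by case: _ / eX; case: _ / eY; case: _ / eZ. Qed.

Lemma fmap_hom_cast (C D : category) (F : functor C D) (X X' Y Y' : obj C)
    (eX : X = X') (eY : Y = Y') (f : hom X Y) :
  fmap F (hom_cast eX eY f) =
  hom_cast (congr1 (fobj F) eX) (congr1 (fobj F) eY) (fmap F f).
Proof. by case: _ / eX; case: _ / eY. Qed.

(** The action on morphisms is compared through a cast, since the two functors
    are only provably equal on objects. *)
Lemma functor_ext (C D : category) (F G : functor C D)
    (e : forall X, fobj F X = fobj G X) :
  (forall X Y (f : hom X Y), hom_cast (e X) (e Y) (fmap F f) = fmap G f) ->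
  F = G.
Proof.
case: F G e => [F Fm F1 FM] [G Gm G1 GM] /= e FG.
have eFG : F = G by apply: funext.
subst G; have {FG} eFG : Fm = Gm.
  apply: functional_extensionality_dep => X.
  apply: functional_extensionality_dep => Y.
  by apply: funext => f; rewrite -FG hom_cast_id.
by subst Gm; rewrite (Prop_irrelevance F1 G1) (Prop_irrelevance FM GM).
Qed.

(** The inverse functor sends [f] to the only morphism that [F] maps to [f];
    since [F (g X)] is only provably equal to [X], both [f] and the two
    identities of functors are read through casts along such equalities. *)
Lemma bijective_functor_isomorphic (C D : category) (F : functor C D) :
  bijective (fobj F) -> (forall X Y, bijective (@fmap C D F X Y)) ->
  cat_isomorphic C D.
Proof.
case=> g FK gK Fbij.
have Fex X Y : {h | cancel h (@fmap _ _ F X Y)}.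
  by apply: cid; case: (Fbij X Y) => h _ hK; exists h.
pose Fi X Y := sval (Fex X Y).
have FiK X Y : cancel (Fi X Y) (@fmap _ _ F X Y) by exact: svalP (Fex X Y).
have Finj X Y : injective (@fmap _ _ F X Y) by exact: bij_inj.
pose Gm X Y (f : hom X Y) :=
  Fi (g X) (g Y) (hom_cast (esym (gK X)) (esym (gK Y)) f).
have G1 X : Gm X X (idm X) = idm (g X).
  by apply: Finj; rewrite FiK fmap_id hom_cast_idm.
have GM X Y Z (h : hom Y Z) (f : hom X Y) :
    Gm X Z (cmp h f) = cmp (Gm Y Z h) (Gm X Y f).
  by apply: Finj; rewrite fmap_cmp !FiK -hom_cast_cmp.
exists F, (Functor G1 GM); split.
- apply: (@functor_ext D D (functor_comp F (Functor G1 GM)) (functor_id D) gK).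
  move=> X Y f /=.
  by rewrite FiK hom_cast_trans hom_cast_id.
- apply: (@functor_ext C C (functor_comp (Functor G1 GM) F) (functor_id C) FK).
  move=> X Y f /=.
  by apply: Finj; rewrite fmap_hom_cast FiK hom_cast_trans hom_cast_id.
Qed.

Lemma cat_isomorphic_sym (C D : category) :
  cat_isomorphic C D -> cat_isomorphic D C.
Proof. by case=> F [G [FG GF]]; exists G, F. Qed.

Lemma full_subcategory_isomorphic (C D : category) (F : functor C D)
    (P : obj C -> Prop) (Q : obj D -> Prop) :
  bijective (fobj F) -> (forall X Y, bijective (@fmap C D F X Y)) ->
  (forall X, P X <-> Q (fobj F X)) ->
  cat_isomorphic (full_subcategory P) (full_subcategory Q).
Proof.
case=> g FK gK Fbij PQ.
pose Fo (X : obj (full_subcategory P)) : obj (full_subcategory Q) :=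
  exist _ (fobj F (sval X)) (iffLR (PQ _) (svalP X)).
have Qg Y : Q Y -> P (g Y) by move=> QY; apply/PQ; rewrite gK.
pose Go (Y : obj (full_subcategory Q)) : obj (full_subcategory P) :=
  exist _ (g (sval Y)) (Qg _ (svalP Y)).
pose F' := @Functor (full_subcategory P) (full_subcategory Q) Fo
  (fun X Y f => fmap F f) (fun X => fmap_id F (sval X))
  (fun X Y Z => @fmap_cmp _ _ F (sval X) (sval Y) (sval Z)).
apply: (@bijective_functor_isomorphic _ _ F') => [|X Y]; last exact: Fbij.
by exists Go => -[X PX]; apply: eq_exist; rewrite /= ?FK ?gK.
Qed.

End BijectiveFunctors.

(** * Direct sums and polynomials *)

(* Keeps coefficients of sums and products folded under simplification. *)
Arguments dcoef : simpl never.

Section DirectSums.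
Variable M : nat -> zmodType.
Implicit Types m : dsum M.

Lemma dcoef0 k : (0 : dsum M) k = 0. Proof. by []. Qed.

Lemma dcoefD m1 m2 k : (m1 + m2) k = m1 k + m2 k. Proof. by []. Qed.

Lemma dcoefN m k : (- m) k = - m k. Proof. by []. Qed.

Lemma dcoef_sum (I : Type) (r : seq I) (P : pred I) (f : I -> dsum M) k :
  (\sum_(i <- r | P i) f i) k = \sum_(i <- r | P i) f i k.
Proof. exact: (big_morph (fun m => m k)). Qed.

Fact dsingle_fin i (x : M i) : exists n : nat, forall k, (n <= k)%N ->
  (if i =P k is ReflectT e then ecast j (M j) e x else 0) = 0.
Proof.
exists i.+1 => k ik; case: eqP => // e; exfalso.
by move: ik; rewrite e ltnn.
Qed.

Definition dsingle i (x : M i) : dsum M := DSum (dsingle_fin x).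

Lemma dsingle_eq i (x : M i) : dsingle x i = x.
Proof.
rewrite /dsingle /dcoef; case: eqP => // e.
by rewrite (Prop_irrelevance e erefl).
Qed.

Lemma dsingle_neq i (x : M i) k : k != i -> dsingle x k = 0.
Proof. by rewrite eq_sym /dsingle /dcoef; case: eqP. Qed.

Lemma dsingle_homogeneous i (x : M i) : homogeneous i (dsingle x).
Proof. by move=> k; exact: dsingle_neq. Qed.

Lemma homogeneousE i m : homogeneous i m -> m = dsingle (m i).
Proof.
move=> mi; apply: dsumP => k; have [->|ki] := eqVneq k i.
  by rewrite dsingle_eq.
by rewrite dsingle_neq ?mi.
Qed.

Lemma dsingleD i (x y : M i) : dsingle (x + y) = dsingle x + dsingle y.
Proof.
apply: dsumP => k; rewrite dcoefD; have [->|ki] := eqVneq k i.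
  by rewrite !dsingle_eq.
by rewrite !dsingle_neq ?addr0.
Qed.

Lemma dsingle0 i : dsingle (0 : M i) = 0.
Proof.
apply: dsumP => k; have [->|ki] := eqVneq k i; first by rewrite dsingle_eq.
by rewrite dsingle_neq.
Qed.

Lemma dsingle_sum i (I : Type) (r : seq I) (P : pred I) (f : I -> M i) :
  dsingle (\sum_(j <- r | P j) f j) = \sum_(j <- r | P j) dsingle (f j).
Proof.
exact: (big_morph (@dsingle i) (@dsingleD i) (dsingle0 i)).
Qed.

Lemma dsum_decomp m n : (forall k, (n <= k)%N -> m k = 0) ->
  m = \sum_(i < n) dsingle (m i).
Proof.
move=> m_n; apply: dsumP => k; rewrite dcoef_sum.
have [nk|kn] := leqP n k.
  rewrite m_n // big1 // => i _; rewrite dsingle_neq // gtn_eqF //.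
  exact: leq_trans (ltn_ord i) nk.
rewrite (bigD1 (Ordinal kn)) // dsingle_eq /= big1 ?addr0 // => i ik.
by rewrite dsingle_neq // eq_sym.
Qed.

End DirectSums.

Section Polynomials.
Variable R : pzRingType.
Implicit Types (p q : tpoly R) (c : R).

Lemma tcoefM p q k : (p * q) k = \sum_(i < k.+1) (p i : R) * (q (k - i)%N : R).
Proof. by []. Qed.

Lemma tcoefMr p q k : (p * q) k = \sum_(i < k.+1) (p (k - i)%N : R) * (q i : R).
Proof. exact: coef_tpoly_mul_rev. Qed.

Lemma tcoefC c k : tpolyC c k = if k == 0%N then c else 0. Proof. by []. Qed.

Lemma tcoefCM c p k : (tpolyC c * p) k = c * (p k : R).
Proof.
rewrite tcoefM big_ord_recl subn0 big1 ?addr0 // => i _.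
by rewrite tcoefC mul0r.
Qed.

Lemma tcoefXS p k : (tpolyX R * p) k.+1 = p k.
Proof.
rewrite tcoefM big_ord_recl mul0r add0r big_ord_recl mul1r /= subn1 /=.
by rewrite big1 ?addr0 // => i _; rewrite mul0r.
Qed.

Lemma tcoefX0 p : (tpolyX R * p) 0%N = 0.
Proof. by rewrite tcoefM big_ord1 mul0r. Qed.

Lemma tcoefXn_lt p n k : (k < n)%N -> (tpolyX R ^+ n * p) k = 0.
Proof.
elim: n k => // n IHn [|k] kn; rewrite exprS -mulrA ?tcoefX0 //.
by rewrite tcoefXS IHn.
Qed.

Lemma tcoefXn p n k : (tpolyX R ^+ n * p) (n + k)%N = p k.
Proof.
by elim: n k => [|n IHn] k; rewrite ?mul1r // exprS -mulrA addSn tcoefXS IHn.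
Qed.

Lemma tcoefM_Xn p q k n : (k < n)%N -> (p * q) k =
  \sum_(j < n) (p j : R) * ((tpolyX R ^+ j * q) k : R).
Proof.
move=> kn; rewrite tcoefM.
rewrite (big_ord_widen n (fun j => (p j : R) * (q (k - j)%N : R))) //.
rewrite big_mkcond /=; apply: eq_bigr => j _; rewrite ltnS.
case: leqP => [jk|kj]; first by rewrite -[in RHS](subnKC jk) tcoefXn.
by rewrite tcoefXn_lt ?mulr0.
Qed.

Lemma tcoef1 k : (1 : tpoly R) k = if k == 0%N then 1 else 0. Proof. by []. Qed.

Lemma tpolyXn_eq n k : (tpolyX R ^+ n) k = if k == n then 1 else 0.
Proof.
rewrite -[_ ^+ n]mulr1; have [kn|nk] := ltnP k n.
  by rewrite tcoefXn_lt // ltn_eqF.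
by rewrite -{1}(subnKC nk) tcoefXn tcoef1 subn_eq0 eqn_leq nk andbT.
Qed.

Lemma tpolyC1 : tpolyC (1 : R) = 1. Proof. by []. Qed.

Lemma tpolyCD c d : tpolyC (c + d) = tpolyC c + tpolyC d.
Proof.
by apply: dsumP => k; rewrite dcoefD !tcoefC; case: ifP; rewrite ?addr0.
Qed.

Lemma tpolyCM c d : tpolyC (c * d) = tpolyC c * tpolyC d.
Proof.
by apply: dsumP => k; rewrite tcoefCM !tcoefC; case: k => //=; rewrite mulr0.
Qed.

Lemma tpolyC0 : tpolyC (0 : R) = 0.
Proof. by apply: dsumP => k; rewrite tcoefC if_same. Qed.

Lemma tpolyCX c n : tpolyC c * tpolyX R ^+ n = tpolyX R ^+ n * tpolyC c.
Proof.
apply: dsumP => k; rewrite tcoefCM tpolyXn_eq; have [kn|nk] := ltnP k n.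
  by rewrite tcoefXn_lt // ltn_eqF // mulr0.
rewrite -{2}(subnKC nk) tcoefXn tcoefC subn_eq0 eqn_leq nk andbT.
by case: ifP; rewrite ?mulr1 ?mulr0.
Qed.

Lemma tpoly_decomp p n : (forall k, (n <= k)%N -> p k = 0) ->
  p = \sum_(i < n) tpolyC (p i) * tpolyX R ^+ i.
Proof.
move=> /(@dsum_decomp _ p) {1}->; apply: eq_bigr => i _; apply: dsumP => k.
rewrite tcoefCM tpolyXn_eq; have [->|ki] := eqVneq k i.
  by rewrite dsingle_eq mulr1.
by rewrite dsingle_neq ?mulr0.
Qed.

Lemma tpolyC_homogeneous c : tpoly_homogeneous 0 (tpolyC c).
Proof. by exists c; rewrite mulr1. Qed.

Lemma tpolyX_homogeneous n : tpoly_homogeneous n (tpolyX R ^+ n).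
Proof. by exists 1; rewrite mul1r. Qed.

End Polynomials.

(** * From persistence modules to graded modules *)

Section GradedOfDapm.
Variable R : pzRingType.

(** The structure maps extended by zero to all pairs of indices, so that
    double sums over them can be rearranged without carrying proofs. *)
Definition shift (M : dapm R) i k : {linear pm_comp M i -> pm_comp M k} :=
  if decP (@idP (i <= k)%N) is left ik then pm_map M ik else \0.

Section Shift.
Variable M : dapm R.

Lemma shiftE i k (ik : (i <= k)%N) x : shift M i k x = pm_map M ik x.
Proof.
by rewrite /shift; case: decP => // ik'; rewrite (Prop_irrelevance ik ik').
Qed.

Lemma shift_id i x : shift M i i x = x.
Proof. by rewrite (shiftE (leqnn i)) pm_map_id. Qed.

Lemma shift_comp i j k x : (i <= j)%N -> (j <= k)%N ->
  shift M j k (shift M i j x) = shift M i k x.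
Proof.
move=> ij jk; rewrite (shiftE ij) (shiftE jk) (shiftE (leq_trans ij jk)).
by rewrite (pm_map_cmp ij jk).
Qed.

Local Notation C := (fun i => pm_comp M i : zmodType).
Local Notation V := (dsum C).
Implicit Types (p q : tpoly R) (m : V).

Fact act_fin p m : exists n : nat, forall k, (n <= k)%N ->
  \sum_(i < k.+1) (p (k - i)%N : R) *: shift M i k (m i) = 0.
Proof.
have [n1 p0] := dcoef_fin p; have [n2 m0] := dcoef_fin m.
exists (n1 + n2)%N => k le_n_k; rewrite big1 // => i _.
have [/m0->|lt_i_n2] := leqP n2 i; first by rewrite linear0 scaler0.
rewrite p0 ?scale0r // leq_subRL; last by rewrite -ltnS.
by rewrite addnC (leq_trans _ le_n_k) // leq_add2l ltnW.
Qed.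

Definition act p m : V := DSum (act_fin p m).

Lemma actE p m k :
  act p m k = \sum_(i < k.+1) (p (k - i)%N : R) *: shift M i k (m i).
Proof. by []. Qed.

Fact actA p q m : act p (act q m) = act (p * q) m.
Proof.
apply: dsumP => k; rewrite !actE.
pose F i j := ((p (k - i)%N : R) * (q (i - j)%N : R)) *: shift M j k (m j).
transitivity (\sum_(i < k.+1) \sum_(j < k.+1 | (j <= i)%N) F i j).
  apply: eq_bigr => i _; rewrite actE linear_sum scaler_sumr /=.
  rewrite (big_ord_narrow_leq (leq_ord i)) /=; apply: eq_bigr => j _.
  by rewrite linearZ /= scalerA shift_comp // -ltnS.
rewrite (exchange_big_dep predT) //; apply: eq_bigr => j _.
rewrite tcoefMr scaler_suml.
transitivity (\sum_(j <= i < k.+1) F i j).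
  by rewrite big_geq_mkord.
rewrite -{1}[val j]add0n big_addn big_mkord subSn ?leq_ord //.
by apply: eq_bigr => i _; rewrite /F addnK -subnDA [(j + i)%N]addnC.
Qed.

Fact act1 : left_id 1 act.
Proof.
move=> m; apply: dsumP => k.
rewrite actE big_ord_recr /= subnn scale1r shift_id.
rewrite big1 ?add0r // => i _; rewrite tcoef1 subn_eq0 leqNgt ltn_ord.
by rewrite scale0r.
Qed.

Fact actDr : right_distributive act +%R.
Proof.
move=> p m1 m2; apply: dsumP => k; rewrite dcoefD !actE -big_split /=.
by apply: eq_bigr => i _; rewrite linearD scalerDr.
Qed.

Fact actDl m : {morph act^~ m : p q / p + q}.
Proof.
move=> p q; apply: dsumP => k; rewrite dcoefD !actE -big_split /=.
by apply: eq_bigr => i _; rewrite scalerDl.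
Qed.

Lemma act_monomial c n i (x : pm_comp M i) k :
  act (tpolyC c * tpolyX R ^+ n) (@dsingle C i x) k =
  if k == (n + i)%N then c *: shift M i k x else 0.
Proof.
have E : forall j : 'I_k.+1, (j : nat) != i ->
    ((tpolyC c * tpolyX R ^+ n) (k - j)%N : R) *:
      shift M j k (@dsingle C i x j) = 0.
  by move=> j ji; rewrite dsingle_neq // linear0 scaler0.
have [ik|ki] := ltnP i k.+1; last first.
  rewrite ltn_eqF ?ltn_addl // actE big1 // => j _; apply: E.
  by rewrite ltn_eqF // (leq_trans (ltn_ord j) ki).
rewrite actE (bigD1 (Ordinal ik)) //= dsingle_eq big1 => [|j /E//].
rewrite addr0 tcoefCM tpolyXn_eq -(eqn_add2r i) subnK //.
by case: ifP; rewrite ?mulr1 // mulr0 scale0r.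
Qed.

Fact act_homogeneous i j s m : tpoly_homogeneous i s -> homogeneous j m ->
  homogeneous (i + j) (act s m).
Proof.
by move=> [c ->] /homogeneousE-> k; rewrite act_monomial => /negPf->.
Qed.

Definition graded_of_dapm : graded_module R :=
  GradedModule actA act1 actDr actDl act_homogeneous.

End Shift.
End GradedOfDapm.

Section GradedHom.
Variables (R : pzRingType) (M N : graded_module R) (f : graded_hom M N).

Lemma gr_fun_dsingle i (x : gr_comp M i) :
  f (dsingle x) = dsingle (dcoef (f (dsingle x)) i).
Proof. exact/homogeneousE/gr_fun_homogeneous/dsingle_homogeneous. Qed.

(** The other homogeneous components of [m] are sent to other degrees. *)
Lemma gr_fun_coef (m : gr_carrier M) i :
  dcoef (f m) i = dcoef (f (dsingle (dcoef m i))) i.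
Proof.
have [n m0] := dcoef_fin m.
rewrite {1}(@dsum_decomp _ m (maxn n i.+1)); last first.
  by move=> k; rewrite geq_max => /andP[/m0].
have -> : f (\sum_(j < maxn n i.+1) dsingle (dcoef m j) : gr_carrier M) =
    \sum_(j < maxn n i.+1) f (dsingle (dcoef m j)).
  exact: (linear_sum f).
have i_lt : (i < maxn n i.+1)%N by rewrite leq_max ltnSn orbT.
rewrite (dcoef_sum (M := gr_comp N)) (bigD1 (Ordinal i_lt)) //=.
rewrite big1 ?addr0 // => j ji.
by rewrite gr_fun_dsingle dsingle_neq // eq_sym.
Qed.

End GradedHom.

Section GradedOfDapmFunctor.
Variable R : pzRingType.

Section Map.
Variables (M N : dapm R) (g : dapm_hom M N).

Lemma shift_nat i k x : shift N i k (pm_fun g i x) = pm_fun g k (shift M i k x).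
Proof.
have [ik|ki] := boolP (i <= k)%N; first by rewrite !(shiftE ik) pm_fun_nat.
by rewrite /shift; case: decP => [ik|_]; [rewrite ik in ki|rewrite /= linear0].
Qed.

Fact dmap_fin (m : gr_carrier (graded_of_dapm M)) : exists n : nat,
  forall i, (n <= i)%N -> pm_fun g i (dcoef m i) = 0.
Proof. by have [n m0] := dcoef_fin m; exists n => i /m0->; rewrite linear0. Qed.

Definition dmap (m : gr_carrier (graded_of_dapm M)) :
    gr_carrier (graded_of_dapm N) :=
  DSum (M := gr_comp (graded_of_dapm N)) (dmap_fin m).

Lemma dmapE m i : dcoef (dmap m) i = pm_fun g i (dcoef m i). Proof. by []. Qed.

Fact dmap_linear : linear dmap.
Proof.
move=> p m1 m2; apply: dsumP => k; rewrite dcoefD !dmapE.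
rewrite dcoefD linearD /= [X in _ = X + _]actE [dcoef (p *: m1) k]actE.
rewrite linear_sum /=; congr (_ + _); apply: eq_bigr => i _.
by rewrite linearZ /= dmapE shift_nat.
Qed.

HB.instance Definition _ := GRing.isLinear.Build (tpoly R)
  (gr_carrier (graded_of_dapm M)) (gr_carrier (graded_of_dapm N)) _ dmap
  dmap_linear.

Fact dmap_homogeneous i (m : dsum (gr_comp (graded_of_dapm M))) :
  homogeneous i m -> homogeneous i (dmap m).
Proof. by move=> mi k ki; rewrite dmapE mi // linear0. Qed.

Definition graded_map : graded_hom (graded_of_dapm M) (graded_of_dapm N) :=
  GradedHom dmap_homogeneous.

End Map.

#[local] Obligation Tactic := idtac.
Program Definition graded_functor : functor (dapm_cat R) (graded_cat R) :=
  @Functor (dapm_cat R) (graded_cat R) (@graded_of_dapm R) graded_map _ _.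
Next Obligation. by move=> M; apply: graded_hom_ext => m; exact: dsumP. Qed.
Next Obligation. by move=> *; apply: graded_hom_ext => m; exact: dsumP. Qed.

Section FullyFaithful.
Variables M N : dapm R.
Local Notation C := (gr_comp (graded_of_dapm M)).
Variable f : graded_hom (graded_of_dapm M) (graded_of_dapm N).

(** The only candidate for the preimage of [f]: the restriction of [f] to the
    component of degree [i], which [f] preserves. *)
Definition hom_coef i (x : pm_comp M i) : pm_comp N i :=
  dcoef (f (@dsingle C i x)) i.

Fact hom_coef_linear i : linear (@hom_coef i).
Proof.
move=> c x y; rewrite /hom_coef.
have -> : @dsingle C i (c *: x + y) =
    tpolyC c *: (@dsingle C i x : gr_carrier (graded_of_dapm M)) +
    @dsingle C i y.
  apply: dsumP => k; rewrite dcoefD.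
  rewrite -[tpolyC c]mulr1 -(expr0 (tpolyX R)) [X in _ = X + _]act_monomial.
  have [->|ki] := eqVneq k i; first by rewrite !dsingle_eq shift_id.
  by rewrite !dsingle_neq // addr0.
rewrite linearD /= linearZ /= dcoefD; congr (_ + _).
rewrite -[tpolyC c]mulr1 -(expr0 (tpolyX R)) [f _]gr_fun_dsingle.
by rewrite [LHS]act_monomial eqxx shift_id dsingle_eq.
Qed.

HB.instance Definition _ i := GRing.isLinear.Build R _ _ _ (@hom_coef i)
  (@hom_coef_linear i).

Fact hom_coef_nat i j (ij : (i <= j)%N) x :
  pm_map N ij (hom_coef x) = hom_coef (pm_map M ij x).
Proof.
have mapE (L : dapm R) (y : pm_comp L i) :
    @dsingle (gr_comp (graded_of_dapm L)) j (pm_map L ij y) =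
    (tpolyX R ^+ (j - i)) *:
      (@dsingle (gr_comp (graded_of_dapm L)) i y :
        gr_carrier (graded_of_dapm L)).
  apply: dsumP => k; rewrite -[_ ^+ _]mul1r -tpolyC1 [RHS]act_monomial subnK //.
  have [->|kj] := eqVneq; first by rewrite dsingle_eq shiftE scale1r.
  by rewrite dsingle_neq.
rewrite {2}/hom_coef mapE linearZ /= [f _]gr_fun_dsingle -[X in dcoef X]mapE.
by rewrite dsingle_eq.
Qed.

Definition dapm_hom_of : dapm_hom M N := DapmHom hom_coef_nat.

End FullyFaithful.

Lemma graded_functor_bij M N : bijective (@fmap _ _ graded_functor M N).
Proof.
exists (@dapm_hom_of M N) => g.
- by apply: dapm_hom_ext => i x; rewrite /= /hom_coef dmapE dsingle_eq.
- apply: graded_hom_ext => m; apply: dsumP => i.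
  by rewrite dmapE [RHS]gr_fun_coef.
Qed.

End GradedOfDapmFunctor.

(** * Recovering the persistence module from the graded module *)

Section GradedCoefficients.
Variables (R : pzRingType) (N : graded_module R).
Implicit Types (p s : tpoly R) (m : gr_carrier N).

Lemma gr_scale_dsingle n i s (x : gr_comp N i) : tpoly_homogeneous n s ->
  gr_scale s (dsingle x) = dsingle (dcoef (gr_scale s (dsingle x)) (n + i)).
Proof.
move=> hs; apply: homogeneousE; apply: gr_scale_homogeneous hs _.
exact: dsingle_homogeneous.
Qed.

(** A graded action is determined by multiplication by [t] and by the constants
    on homogeneous elements, with the formula that defines [act]. *)
Lemma gr_scale_coef p m k : dcoef (gr_scale p m) k = \sum_(i < k.+1)
  dcoef (gr_scale (tpolyC (dcoef p (k - i)) * tpolyX R ^+ (k - i))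
                  (dsingle (dcoef m i))) k.
Proof.
have [n1 p0] := dcoef_fin p; have [n2 m0] := dcoef_fin m.
pose n := maxn k.+1 (maxn n1 n2).
have kn : (k < n)%N by rewrite leq_maxl.
have p_n i : (n <= i)%N -> dcoef p i = 0.
  by rewrite !geq_max => /and3P[_ /p0].
have m_n i : (n <= i)%N -> dcoef m i = 0.
  by rewrite !geq_max => /and3P[_ _ /m0].
pose t j : tpoly R := tpolyC (dcoef p j) * tpolyX R ^+ j.
pose F j i := dcoef (gr_scale (t j) (dsingle (dcoef m i))) k.
have F0 j i : k != (j + i)%N -> F j i = 0.
  move=> kij; rewrite /F (@gr_scale_dsingle j) ?dsingle_neq //.
  by exists (dcoef p j).
transitivity (\sum_(i < n) \sum_(j < n) F j i).
  have -> : gr_scale p m = p *: m by [].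
  rewrite {1}(tpoly_decomp p_n) {1}(dsum_decomp m_n) scaler_sumr dcoef_sum.
  by apply: eq_bigr => i _; rewrite scaler_suml dcoef_sum.
rewrite (big_ord_widen n (fun i => F (k - i)%N i)) //.
rewrite [RHS]big_mkcond /=; apply: eq_bigr => i _.
case: ifP => [ik|/negbT ki]; last first.
  by rewrite big1 // => j _; rewrite F0 // ltn_eqF // ltn_addl // leqNgt.
have kin : (k - i < n)%N by apply: leq_ltn_trans kn; rewrite leq_subr.
rewrite (bigD1 (Ordinal kin)) //= big1 ?addr0 // => j jk; rewrite F0 //.
apply: contraNneq jk => kE; apply/eqP/val_inj.
by rewrite /= [X in (X - _)%N]kE addnK.
Qed.

End GradedCoefficients.

Section DapmOfGraded.
Variable R : pzRingType.

(** Module structures on a given abelian group. The carrier of the resulting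
    module is convertible to that of [V], so that the casts below act as the
    identity. *)
Record scaling (V : zmodType) := Scaling {
  scl : R -> V -> V;
  sclA : forall a b v, scl a (scl b v) = scl (a * b) v;
  scl1 : left_id 1 scl;
  sclDr : right_distributive scl +%R;
  sclDl : forall v, {morph scl^~ v : a b / a + b}
}.

Definition scaled (V : zmodType) (s : scaling V) : Type := V.
HB.instance Definition _ V (s : scaling V) := GRing.Zmodule.on (scaled s).
HB.instance Definition _ V (s : scaling V) :=
  GRing.Zmodule_isLmodule.Build R (scaled s) (@sclA V s) (@scl1 V s)
    (@sclDr V s) (@sclDl V s).

Definition linear_of (U V : lmodType R) (f : U -> V) (f_lin : linear f) :
    {linear U -> V} :=
  HB.pack f (GRing.isLinear.Build R U V _ f f_lin).

Section Construction.
Variable N : graded_module R.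
Local Notation C := (gr_comp N).

Definition comp_scale i c (x : C i) : C i :=
  dcoef (gr_scale (tpolyC c) (dsingle x)) i.

Lemma dsingle_comp_scale i c (x : C i) :
  dsingle (comp_scale c x) = gr_scale (tpolyC c) (dsingle x).
Proof. by rewrite [RHS](gr_scale_dsingle _ (tpolyC_homogeneous c)). Qed.

Fact comp_scaleA i a b (x : C i) :
  comp_scale a (comp_scale b x) = comp_scale (a * b) x.
Proof. by rewrite {1}/comp_scale dsingle_comp_scale gr_scaleA -tpolyCM. Qed.

Fact comp_scale1 i : left_id 1 (@comp_scale i).
Proof. by move=> x; rewrite /comp_scale tpolyC1 gr_scale1 dsingle_eq. Qed.

Fact comp_scaleDr i : right_distributive (@comp_scale i) +%R.
Proof.
by move=> c x y; rewrite /comp_scale dsingleD gr_scaleDr dcoefD.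
Qed.

Fact comp_scaleDl i (x : C i) : {morph (@comp_scale i)^~ x : a b / a + b}.
Proof. by move=> a b; rewrite /comp_scale tpolyCD gr_scaleDl dcoefD. Qed.

Definition comp_scaling i : scaling (C i) :=
  Scaling (@comp_scaleA i) (@comp_scale1 i) (@comp_scaleDr i) (@comp_scaleDl i).

Definition comp_lmod i : lmodType R := scaled (comp_scaling i).

Definition comp_map i j (x : comp_lmod i) : comp_lmod j :=
  dcoef (gr_scale (tpolyX R ^+ (j - i)) (@dsingle C i x)) j.

Lemma dsingle_comp_map i j (ij : (i <= j)%N) (x : C i) :
  dsingle (comp_map j x : C j) = gr_scale (tpolyX R ^+ (j - i)) (dsingle x).
Proof.
by rewrite [RHS](gr_scale_dsingle _ (tpolyX_homogeneous R (j - i))) subnK.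
Qed.

Fact comp_map_linear i j (ij : (i <= j)%N) : linear (@comp_map i j).
Proof.
move=> c x y; rewrite {1}/comp_map.
have -> : @dsingle C i (c *: x + y) =
    gr_scale (tpolyC c) (@dsingle C i x) + @dsingle C i y.
  by rewrite -dsingle_comp_scale -dsingleD.
rewrite gr_scaleDr dcoefD gr_scaleA -tpolyCX -gr_scaleA.
by rewrite -[gr_scale (_ ^+ _) (@dsingle C i x)]dsingle_comp_map.
Qed.

Fact comp_map_id i (ii : (i <= i)%N) (x : comp_lmod i) :
  linear_of (comp_map_linear ii) x = x.
Proof. by rewrite /= /comp_map subnn gr_scale1 dsingle_eq. Qed.

Fact comp_map_cmp i j k (ij : (i <= j)%N) (jk : (j <= k)%N) (ik : (i <= k)%N)
    (x : comp_lmod i) :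
  linear_of (comp_map_linear ik) x =
  linear_of (comp_map_linear jk) (linear_of (comp_map_linear ij) x).
Proof.
rewrite /= [in RHS]/comp_map dsingle_comp_map // gr_scaleA -exprD.
by rewrite addnBA // subnK.
Qed.

Definition dapm_of_graded : dapm R := Dapm comp_map_id comp_map_cmp.

End Construction.
Definition zmod_cast (V W : zmodType) (e : V = W) (x : V) : W :=
  ecast Z (Z : Type) e x.

Definition lmod_cast (V W : lmodType R) (e : V = W) (x : V) : W :=
  ecast L (L : Type) e x.

(** The structure has no eta-conversion, hence a provable equality only. *)
Lemma zmod_scaled (V : zmodType) (s : scaling V) : (scaled s : zmodType) = V.
Proof. by case: V s. Qed.

Lemma zmod_cast_scaled (V : zmodType) (s : scaling V)
  (e : (scaled s : zmodType) = V) (x : scaled s) : zmod_cast e x = x.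
Proof. by case: V s e x => V cV s e x; rewrite (Prop_irrelevance e erefl). Qed.

(** Equality of graded modules whose components are only provably equal:
    the actions have to agree through the casts of the components. *)
Lemma graded_module_ext (M N : graded_module R)
    (e : forall i, gr_comp M i = gr_comp N i) :
  (forall p (m : dsum (gr_comp M)) (n : dsum (gr_comp N)),
    (forall i, zmod_cast (e i) (m i) = n i) ->
    forall i, zmod_cast (e i) (gr_scale p m i) = gr_scale p n i) ->
  M = N.
Proof.
case: M N e => [C a a1 a2 a3 a4 a5] [C' b b1 b2 b3 b4 b5] /= e ab.
have eC : C = C' by apply: funext.
subst C'.
have {}ab : a = b.
  apply: funext => p; apply: funext => m; apply: dsumP => i.
  rewrite -(ab p m m) => [|j]; first by rewrite (Prop_irrelevance (e i) erefl).
  by rewrite (Prop_irrelevance (e j) erefl).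
by subst b; congr GradedModule; exact: Prop_irrelevance.
Qed.

Lemma dapm_ext (M N : dapm R) (e : forall i, pm_comp M i = pm_comp N i) :
  (forall i j (ij : (i <= j)%N) x,
    lmod_cast (e j) (pm_map M ij x) = pm_map N ij (lmod_cast (e i) x)) ->
  M = N.
Proof.
case: M N e => [C a a1 a2] [C' b b1 b2] /= e ab.
have eC : C = C' by apply: funext.
subst C'.
have {}ab : a = b.
  apply: functional_extensionality_dep => i.
  apply: functional_extensionality_dep => j.
  apply: functional_extensionality_dep => ij; apply: linear_ext => x.
  have := ab i j ij x.
  by rewrite (Prop_irrelevance (e i) erefl) (Prop_irrelevance (e j) erefl).
by subst b; congr Dapm; exact: Prop_irrelevance.
Qed.

Lemma dapm_of_gradedK (N : graded_module R) :
  graded_of_dapm (dapm_of_graded N) = N.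
Proof.
have e i : gr_comp (graded_of_dapm (dapm_of_graded N)) i = gr_comp N i.
  exact: zmod_scaled.
apply: (graded_module_ext (e := e)) => p m n mn k.
rewrite zmod_cast_scaled (gr_scale_coef p n k) [LHS]actE.
apply: eq_bigr => i _; rewrite (shiftE (leq_ord i)).
rewrite -mn zmod_cast_scaled.
rewrite [LHS](_ : _ = comp_scale (p (k - i)%N) (comp_map (i := i) k (m i))) //.
by rewrite /comp_scale dsingle_comp_map ?leq_ord // gr_scaleA.
Qed.

(** The existential packs the equality with the fact that transport along it
    fixes every element: both come from the same analysis of the structure,
    where two modules on one group are equal once their scalings are. *)
Lemma lmod_scaled (V : lmodType R) (s : scaling V) :
  (forall c x, scl s c x = c *: x) ->
  exists e : (scaled s : lmodType R) = V, forall x, lmod_cast e x = x.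
Proof.
case: V s => V [z a m h1 h2 h3 h4 h5 h6 [sc p1 p2 p3 p4 p5]].
case=> sc' q1 q2 q3 q4 scE.
have {}scE : sc' = sc by apply: funext => c; apply: funext => x; exact: scE.
subst sc'.
pose mixin := GRing.Nmodule_isLSemiModule.axioms_ R V a m h2 h3 h4 h5 h6.
pose lmod_with (mx : mixin) : lmodType R :=
  GRing.Lmodule.Pack (GRing.Lmodule.Class (M := V) h1 mx).
have cast_with (mx mx' : mixin) (e : mx = mx') :
    forall x : V, lmod_cast (congr1 lmod_with e) x = x by case: _ / e.
pose s := Scaling q1 q2 q3 q4.
pose mx : mixin := GRing.Lmodule.GRing_Nmodule_isLSemiModule_mixin
  (GRing.Lmodule.class (scaled s)).
have e : mx = GRing.Nmodule_isLSemiModule.Axioms_ h6 sc p1 p2 p3 p4 p5.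
  by congr GRing.Nmodule_isLSemiModule.Axioms_; exact: Prop_irrelevance.
by exists (congr1 lmod_with e) => x; exact: cast_with.
Qed.

Lemma graded_of_dapmK (M : dapm R) : dapm_of_graded (graded_of_dapm M) = M.
Proof.
have sclE i c (x : pm_comp M i) :
    @comp_scale (graded_of_dapm M) i c x = c *: x.
  rewrite /comp_scale -[tpolyC c]mulr1 -(expr0 (tpolyX R)) [LHS]act_monomial.
  by rewrite eqxx shift_id.
pose N := dapm_of_graded (graded_of_dapm M).
pose s i : scaling (pm_comp M i) := comp_scaling (graded_of_dapm M) i.
have e i : pm_comp N i = pm_comp M i.
  by have [] := lmod_scaled (s := s i) (@sclE i).
have eE i (x : pm_comp N i) : lmod_cast (e i) x = x.
  have [e' e'E] := lmod_scaled (s := s i) (@sclE i).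
  by rewrite (Prop_irrelevance (e i) e'); exact: e'E.
apply: (dapm_ext (e := e)) => i j ij x; rewrite !eE /= /comp_map.
rewrite -[_ ^+ _]mul1r -tpolyC1 [LHS]act_monomial subnK // eqxx scale1r.
by rewrite shiftE.
Qed.

End DapmOfGraded.

Lemma graded_functor_obj_bij (R : pzRingType) :
  bijective (fobj (graded_functor R)).
Proof.
by exists (@dapm_of_graded R); [exact: graded_of_dapmK|exact: dapm_of_gradedK].
Qed.

(** * Finite presentations by generators and relations *)

Section FinitePresentation.
Variables (S : pzRingType) (V : lmodType S).

(** Index sets are arbitrary finite types, which lets generators and relators be
    indexed by products and sums. *)
Definition presentation (A B : finType) (g : A -> V) (r : B -> A -> S) : Prop :=
  [/\ forall v, exists c : A -> S, v = \sum_a c a *: g a,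
      forall b, \sum_a r b a *: g a = 0 &
      forall c : A -> S, \sum_a c a *: g a = 0 ->
        exists d : B -> S, forall a, c a = \sum_b d b * r b a].

Lemma presentation_fp (A B : finType) (g : A -> V) (r : B -> A -> S) :
  presentation g r -> finitely_presented V.
Proof.
case=> gen rel0 relP.
pose F (w : 'rV[S]_#|B|) : 'rV[S]_#|A| :=
  \row_j \sum_i w 0 i * r (enum_val i) (enum_val j).
pose H (u : 'rV[S]_#|A|) : V := \sum_j u 0 j *: g (enum_val j).
have F_lin : linear F.
  move=> a u v; apply/rowP => j; rewrite !mxE mulr_sumr -big_split /=.
  by apply: eq_bigr => i _; rewrite !mxE mulrDl mulrA.
have H_lin : linear H.
  move=> a u v; rewrite /H scaler_sumr -big_split /=.
  by apply: eq_bigr => i _; rewrite !mxE scalerDl scalerA.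
have HE (c : A -> S) : H (\row_j c (enum_val j)) = \sum_a c a *: g a.
  rewrite (reindex _ (onW_bij _ (@enum_val_bij _))) //=.
  by apply: eq_bigr => j _; rewrite mxE.
exists #|B|, #|A|, (linear_of F_lin), (linear_of H_lin); split => [u|v] /=.
- have uE : u = \row_j (fun a => u 0 (enum_rank a)) (enum_val j).
    by apply/rowP => j; rewrite mxE enum_valK.
  split=> [|[w <-]].
  + rewrite [in H u]uE (HE (fun a => u 0 (enum_rank a))) => /relP[d dE].
    exists (\row_i d (enum_val i)); apply/rowP => j.
    rewrite [in RHS]uE !mxE dE.
    rewrite [RHS](reindex _ (onW_bij _ (@enum_val_bij _))) //=.
    by apply: eq_bigr => i _; rewrite mxE.
  + rewrite (HE (fun a => \sum_i w 0 i * r (enum_val i) a)).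
    under eq_bigr do rewrite scaler_suml.
    rewrite exchange_big big1 //= => i _.
    by under eq_bigr do rewrite -scalerA; rewrite -scaler_sumr rel0 scaler0.
- have [c ->] := gen v; exists (\row_j c (enum_val j)); exact: HE.
Qed.

Lemma fp_presentation : finitely_presented V ->
  exists (m n : nat) (g : 'I_n -> V) (r : 'I_m -> 'I_n -> S), presentation g r.
Proof.
case=> m [n [f [h [hf hsurj]]]].
have hE u : h u = \sum_j u 0 j *: h (delta_mx 0 j).
  rewrite {1}[u]row_sum_delta linear_sum; apply: eq_bigr => j _.
  by rewrite linearZ.
exists m, n, (fun j => h (delta_mx 0 j)), (fun i j => f (delta_mx 0 i) 0 j).
split=> [v|i|c].
- by have [u <-] := hsurj v; exists (fun j => u 0 j); exact: hE.
- by rewrite -hE; apply/hf; eexists.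
- have -> : \sum_a c a *: h (delta_mx 0 a) = h (\row_j c j).
    by rewrite hE; apply: eq_bigr => j _; rewrite mxE.
  case/hf=> w wE; exists (fun i => w 0 i) => j.
  have <- : f w 0 j = c j by rewrite wE mxE.
  rewrite {1}[w]row_sum_delta linear_sum summxE; apply: eq_bigr => i _.
  by rewrite linearZ mxE.
Qed.

End FinitePresentation.

(** * Finitely presented graded modules have finitely presented type *)

Lemma dcoef_fin_family (M : nat -> zmodType) (A : finType) (f : A -> dsum M) :
  exists n : nat, forall a k, (n <= k)%N -> f a k = 0.
Proof.
have /choice[n nP] a := dcoef_fin (f a).
exists (\max_a n a) => a k nk; apply: nP.
exact: leq_trans (leq_bigmax a) nk.
Qed.

Lemma bijective_linear_iso (S : pzRingType) (U V : lmodType S)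
    (f : {linear U -> V}) : injective f -> (forall y, exists x, f x = y) ->
  linear_iso f.
Proof.
move=> f_inj /choice[g gK].
have g_lin : linear g by move=> a x y; apply: f_inj; rewrite gK linearP !gK.
exists (linear_of g_lin); split=> [x|//].
by apply: f_inj; rewrite [LHS]gK.
Qed.

Section Action.
Variables (R : pzRingType) (M : dapm R).
Local Notation C := (gr_comp (graded_of_dapm M)).
Local Notation V := (gr_carrier (graded_of_dapm M)).
Implicit Types (p : tpoly R) (v : V).

Lemma coefZ p v k : dcoef (p *: v) k =
  \sum_(i < k.+1) (p (k - i)%N : R) *: shift M i k (dcoef v i).
Proof. by []. Qed.

Lemma coefXnZ n v k : dcoef (tpolyX R ^+ n *: v) k =
  if (n <= k)%N then shift M (k - n) k (dcoef v (k - n)) else 0.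
Proof.
rewrite coefZ; case: leqP => [nk|kn]; last first.
  rewrite big1 // => i _; rewrite tpolyXn_eq ltn_eqF ?scale0r //.
  exact: leq_ltn_trans (leq_subr _ _) kn.
have kn : (k - n < k.+1)%N by rewrite ltnS leq_subr.
rewrite (bigD1 (Ordinal kn)) //= tpolyXn_eq subKn // eqxx scale1r.
rewrite big1 ?addr0 // => i; apply: contraNeq => ni; apply/eqP/val_inj => /=.
rewrite -[LHS](subKn (leq_ord i)); congr (k - _)%N; apply/eqP.
by apply: contra_neqT ni => /negPf ni; rewrite tpolyXn_eq ni scale0r.
Qed.

Lemma coefCZ c v k : dcoef (tpolyC c *: v) k = c *: dcoef v k.
Proof.
rewrite coefZ big_ord_recr /= subnn shift_id big1 ?add0r // => i _.
by rewrite tcoefC subn_eq0 leqNgt ltn_ord scale0r.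
Qed.

(** The same coefficient, indexed by the degree of the polynomial factor. *)
Lemma coefZ_Xn p v k : dcoef (p *: v) k =
  \sum_(j < k.+1) (p j : R) *: dcoef (tpolyX R ^+ j *: v) k.
Proof.
rewrite coefZ (reindex_inj rev_ord_inj) /=; apply: eq_bigr => j _.
by rewrite coefXnZ -ltnS ltn_ord subSS subKn // -ltnS.
Qed.

Lemma coefZ_dsingle p i (x : pm_comp M i) k :
  dcoef (p *: (@dsingle C i x : V)) k =
  if (i <= k)%N then (p (k - i)%N : R) *: shift M i k x else 0.
Proof.
have neq0 (j : nat) : j != i ->
    (p (k - j)%N : R) *: shift M j k (dcoef (@dsingle C i x) j) = 0.
  by move=> ji; rewrite dsingle_neq // linear0 scaler0.
rewrite coefZ; case: leqP => [ik|ki].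
  rewrite (bigD1 (Ordinal (ik : i < k.+1)%N)) //= dsingle_eq.
  rewrite big1 ?addr0 // => j ji.
  by apply: neq0; apply: contraNneq ji => ji; apply/eqP/val_inj.
rewrite big1 // => j _; apply: neq0.
by rewrite ltn_eqF // (leq_ltn_trans (leq_ord j)).
Qed.

Lemma dsingleZ c i (x : pm_comp M i) :
  @dsingle C i (c *: x) = tpolyC c *: (@dsingle C i x : V).
Proof.
apply: dsumP => k; rewrite coefCZ; have [->|ki] := eqVneq k i.
  by rewrite !dsingle_eq.
by rewrite !dsingle_neq // scaler0.
Qed.

Lemma dsingle_shift i k (x : pm_comp M i) : (i <= k)%N ->
  @dsingle C k (shift M i k x) = tpolyX R ^+ (k - i) *: (@dsingle C i x : V).
Proof.
move=> ik; apply: dsumP => l; rewrite coefXnZ.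
have [->|lk] := eqVneq l k.
  by rewrite dsingle_eq leq_subr subKn // dsingle_eq.
rewrite dsingle_neq //; case: ifP => // kil.
rewrite dsingle_neq ?linear0 //; apply: contra_neq lk => li.
by rewrite -(subnK kil) li subnKC.
Qed.

End Action.

Section FromGradedPresentation.
Variables (R : pzRingType) (M : dapm R).
Local Notation C := (gr_comp (graded_of_dapm M)).
Local Notation V := (gr_carrier (graded_of_dapm M)).

Variables (A B : finType) (g : A -> V) (r : B -> A -> tpoly R).
Hypothesis gr_pres : presentation g r.

(** Only the coefficients of degree at most [i] contribute to the component of
    degree [i], whence finitely many generators of that component. *)
Lemma coef_lincomb (c : A -> tpoly R) i :
  dcoef (\sum_a c a *: g a) i =
  \sum_(u : A * 'I_i.+1)
    (dcoef (c u.1) u.2 : R) *: dcoef (tpolyX R ^+ u.2 *: g u.1) i.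
Proof.
rewrite -(pair_bigA _ (fun a (j : 'I_i.+1) =>
  (dcoef (c a) j : R) *: dcoef (tpolyX R ^+ j *: g a) i)) /=.
by rewrite (dcoef_sum (M := C)); apply: eq_bigr => a _; exact: coefZ_Xn.
Qed.

(** The component of degree [i] is a direct summand over R of M / t^(i+1) M; the
    relators [w u] below express the projection onto it. *)
Lemma comp_finitely_presented i : finitely_presented (pm_comp M i).
Proof.
have [gen rel0 relP] := gr_pres.
pose g' (u : A * 'I_i.+1) : pm_comp M i := dcoef (tpolyX R ^+ u.2 *: g u.1) i.
have /choice[w wE] (u : A * 'I_i.+1) : exists w : A -> tpoly R,
    tpolyX R ^+ u.2 *: g u.1 - @dsingle C i (g' u) = \sum_a w a *: g a.
  exact: gen.
pose r' (b : A * 'I_i.+1 + B * 'I_i.+1) (u : A * 'I_i.+1) : R := match b with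
  | inl u' => dcoef (w u' u.1) u.2
  | inr (l, j) => dcoef (tpolyX R ^+ j * r l u.1) u.2
  end.
apply: (@presentation_fp _ _ _ _ g' r'); split=> [x|[u|[l j]]|c].
- have [c cE] := gen (@dsingle C i x).
  exists (fun u : A * 'I_i.+1 => dcoef (c u.1) u.2).
  by rewrite -[LHS](@dsingle_eq C i) cE coef_lincomb.
- rewrite -[LHS](coef_lincomb (w u)) -wE dcoefD dcoefN.
  by rewrite [X in _ - X]dsingle_eq subrr.
- rewrite -[LHS](coef_lincomb (fun a => tpolyX R ^+ j * r l a)).
  have -> : \sum_a (tpolyX R ^+ j * r l a) *: g a = 0.
    by under eq_bigr do rewrite -scalerA; rewrite -scaler_sumr rel0 scaler0.
  by [].
- move=> c0.
  (* Lift [c] to polynomials; the part of [sum p_a g_a] outside degree [i] is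
     the combination [sum c_u w_u], so the difference is a relation. *)
  pose p a := \sum_(j < i.+1) tpolyC (c (a, j)) * tpolyX R ^+ j.
  have pE a (k : 'I_i.+1) : dcoef (p a) k = c (a, k).
    rewrite dcoef_sum (bigD1 k) //= big1 => [|j jk].
      by rewrite addr0 tcoefCM tpolyXn_eq eqxx mulr1.
    rewrite tcoefCM tpolyXn_eq; case: eqP => [/val_inj kj|]; rewrite ?mulr0 //.
    by rewrite kj eqxx in jk.
  have p0 : \sum_a (p a - \sum_u tpolyC (c u) * w u a) *: g a = 0.
    under eq_bigr do rewrite scalerBl; rewrite sumrB.
    under [X in _ - X]eq_bigr do rewrite scaler_suml.
    rewrite exchange_big /=.
    have -> : \sum_a p a *: g a =
        \sum_u tpolyC (c u) *: (tpolyX R ^+ u.2 *: g u.1).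
      under eq_bigr do rewrite scaler_suml.
      rewrite pair_bigA /=; apply: eq_bigr => u _.
      by rewrite -scalerA -surjective_pairing.
    rewrite -sumrB.
    transitivity (\sum_u @dsingle C i (c u *: g' u) : V); last first.
      by rewrite -dsingle_sum c0; apply: dsumP => k; rewrite (@dsingle0 C).
    apply: eq_bigr => u _; rewrite dsingleZ.
    under eq_bigr do rewrite -scalerA.
    by rewrite -scaler_sumr -wE -scalerBr opprB addrC subrK.
  have [q qE] := relP _ p0.
  exists (fun b : A * 'I_i.+1 + B * 'I_i.+1 => match b with
    | inl u => c u
    | inr (l, j) => dcoef (q l) j
    end).
  case=> a k; rewrite -pE big_sumType /=.
  have -> : p a = \sum_u tpolyC (c u) * w u a + \sum_l q l * r l a.
    by rewrite -qE addrC subrK.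
  rewrite dcoefD !dcoef_sum; congr (_ + _).
    by apply: eq_bigr => u _; rewrite tcoefCM.
  transitivity (\sum_l \sum_(j < i.+1)
      (dcoef (q l) j : R) * (dcoef (tpolyX R ^+ j * r l a) k : R)).
    by apply: eq_bigr => l _; rewrite (tcoefM_Xn _ _ (ltn_ord k)).
  by rewrite pair_bigA /=; apply: eq_bigr => -[].
Qed.

(** All generators live in degrees below [D], so what they contribute to degree
    [j] has passed through degree [i]. *)
Lemma shift_surj : exists D, forall i j (x : pm_comp M j),
  (D <= i)%N -> (i <= j)%N -> exists y, shift M i j y = x.
Proof.
have [gen _ _] := gr_pres; have [D g0] := dcoef_fin_family g.
exists D => i j x Di ij; have [c cE] := gen (@dsingle C j x).
exists (\sum_(u : A * 'I_j.+1)
  (dcoef (c u.1) u.2 : R) *: shift M (j - u.2) i (dcoef (g u.1) (j - u.2))).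
rewrite -[RHS](@dsingle_eq C j) cE coef_lincomb linear_sum /=.
apply: eq_bigr => u _; rewrite linearZ /= coefXnZ -ltnS ltn_ord.
have [/g0->|/ltnW ltD] := leqP D (j - u.2); first by rewrite !linear0.
by rewrite shift_comp // (leq_trans ltD).
Qed.

(** Relations between the [g a] divisible by [t] are, up to [t] times a
    relation, combinations of the relators with constant coefficients, and these
    have bounded degree. *)
Lemma shift_inj_step : exists D, forall i (x : pm_comp M i),
  (D <= i)%N -> shift M i i.+1 x = 0 -> x = 0.
Proof.
have [gen rel0 relP] := gr_pres; have [D g0] := dcoef_fin_family g.
have [E r0] := dcoef_fin_family (fun u : B * A => r u.1 u.2).
exists (E + D)%N => i x le_i x0.
have [p pE] := gen (@dsingle C i x).
have [q qE] : exists q : B -> tpoly R,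
    forall a, tpolyX R * p a = \sum_l q l * r l a.
  apply: relP; under eq_bigr do rewrite -scalerA.
  rewrite -scaler_sumr -pE -[tpolyX R]expr1 -(subSnn i) -dsingle_shift // x0.
  by apply: dsumP => k; rewrite (@dsingle0 C).
have tail_fin l : exists n : nat, forall k, (n <= k)%N -> dcoef (q l) k.+1 = 0.
  by have [n q0] := dcoef_fin (q l); exists n => k nk; rewrite q0 // leqW.
pose q' l : tpoly R := DSum (tail_fin l).
have qq' l : q l = tpolyC (dcoef (q l) 0) + tpolyX R * q' l.
  apply: dsumP => -[|k]; rewrite dcoefD tcoefC ?tcoefX0 ?addr0 //.
  by rewrite tcoefXS add0r.
pose s a := p a - \sum_l q' l * r l a.
have sE a : tpolyX R * s a = \sum_l tpolyC (dcoef (q l) 0) * r l a.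
  rewrite mulrBr qE mulr_sumr -sumrB; apply: eq_bigr => l _.
  by rewrite {1}qq' mulrDl mulrA addrK.
have s0 a k : (E <= k)%N -> dcoef (s a) k = 0.
  move=> Ek; rewrite -tcoefXS sE dcoef_sum big1 // => l _.
  by rewrite tcoefCM (r0 (l, a)) ?mulr0 // leqW.
have xE : @dsingle C i x = \sum_a s a *: g a.
  under eq_bigr do rewrite scalerBl; rewrite sumrB -pE.
  under eq_bigr do rewrite scaler_suml.
  rewrite exchange_big [X in _ - X]big1 ?subr0 //= => l _.
  by under eq_bigr do rewrite -scalerA; rewrite -scaler_sumr rel0 scaler0.
rewrite -[LHS](@dsingle_eq C i) xE coef_lincomb big1 // => u _.
have [/s0->|uE] := leqP E u.2; first by rewrite scale0r.
rewrite coefXnZ -ltnS ltn_ord g0 ?linear0 ?scaler0 //.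
rewrite leq_subRL; last by rewrite -ltnS ltn_ord.
by apply: leq_trans le_i; rewrite leq_add2r ltnW.
Qed.

Lemma graded_presentation_finite_type : finite_type M.
Proof.
have [D1 surj] := shift_surj; have [D2 inj] := shift_inj_step.
exists (maxn D1 D2) => i j ij; rewrite geq_max => /andP[D1i D2i].
have inj_ij x : shift M i j x = 0 -> x = 0.
  elim: j ij => [|j IHj]; rewrite leq_eqVlt => /orP[/eqP eij|//].
  - by subst i; rewrite shift_id.
  - by subst i; rewrite shift_id.
  - move=> ij; rewrite -(shift_comp x ij (leqnSn j)) => x0.
    apply: IHj => //; apply: inj x0; exact: leq_trans D2i ij.
apply: bijective_linear_iso => [x y|y].
- rewrite -!(shiftE ij) => /eqP; rewrite -subr_eq0 -linearB => /eqP/inj_ij.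
  by move/eqP; rewrite subr_eq0 => /eqP.
- by have [x <-] := surj i j y D1i ij; exists x; rewrite (shiftE ij).
Qed.

End FromGradedPresentation.

Lemma graded_fp_finitely_presented_type (R : pzRingType) (M : dapm R) :
  finitely_presented (gr_carrier (graded_of_dapm M)) ->
  finitely_presented_type M.
Proof.
case/fp_presentation=> m [n [g [r gr_pres]]].
split; first exact: graded_presentation_finite_type gr_pres.
exact: comp_finitely_presented gr_pres.
Qed.

(** * Persistence modules of finitely presented type *)

Section FromCompPresentations.
Variables (R : pzRingType) (M : dapm R).
Local Notation C := (gr_comp (graded_of_dapm M)).
Local Notation V := (gr_carrier (graded_of_dapm M)).

Variables (D : nat) (a b : nat -> nat).
Variables (g : forall i, 'I_(a i) -> pm_comp M i).
Variables (r : forall i, 'I_(b i) -> 'I_(a i) -> R).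
Hypothesis comp_pres : forall i, presentation (@g i) (@r i).
Hypothesis stable : forall i j, (D <= i)%N -> (i <= j)%N ->
  (forall x, shift M i j x = 0 -> x = 0) /\
  (forall y, exists x, shift M i j x = y).

Lemma shift_minn i k : i = minn k D ->
  (forall x, shift M i k x = 0 -> x = 0) /\
  (forall y, exists x, shift M i k x = y).
Proof.
have [kD ->|Dk ->] := leqP k D; last by apply: stable; rewrite // ltnW.
by split=> [x|y]; [rewrite shift_id|exists y; rewrite shift_id].
Qed.

Let A := {i : 'I_D.+1 & 'I_(a i)}.
Let Free := {ffun A -> (tpoly R)^o}.

Let gen (u : A) : V := @dsingle C (tag u) (g (tagged u)).
Let basis (u : A) : Free := [ffun v => if v == u then 1 else 0].
Let comb (i : 'I_D.+1) (c : 'I_(a i) -> R) : Free :=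
  \sum_k tpolyC (c k) *: basis (Tagged (fun i : 'I_D.+1 => 'I_(a i)) k).

(** The successor, capped at [D]. At [i = D] the corresponding relator is
    a relation of M_D, harmless and uniform with the others. *)
Let next (i : 'I_D.+1) : 'I_D.+1 := inord (minn i.+1 D).

Lemma next_val (i : 'I_D.+1) : next i = minn i.+1 D :> nat.
Proof. by rewrite inordK // ltnS geq_minr. Qed.

Lemma leq_next (i : 'I_D.+1) : (i <= next i)%N.
Proof. by rewrite next_val leq_min leqnSn -ltnS ltn_ord. Qed.

Lemma next_coef_ex : exists c : forall u : A, 'I_(a (next (tag u))) -> R,
  forall u : A, shift M (tag u) (next (tag u)) (g (tagged u)) =
            \sum_k c u k *: g k.
Proof.
have ex (u : A) : exists c : 'I_(a (next (tag u))) -> R,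
    shift M (tag u) (next (tag u)) (g (tagged u)) = \sum_k c k *: g k.
  by case: (comp_pres (next (tag u))) => + _ _; apply.
by exists (fun u : A => sval (cid (ex u))) => u; exact: svalP (cid (ex u)).
Qed.

Let next_coef := sval (cid next_coef_ex).

Let next_coefE (u : A) : shift M (tag u) (next (tag u)) (g (tagged u)) =
  \sum_k @next_coef u k *: g k.
Proof. exact: svalP (cid next_coef_ex) u. Qed.

Let B := ({i : 'I_D.+1 & 'I_(b i)} + A)%type.
Let rel (w : B) : Free := match w with
  | inl l => comb (@r (tag l) (tagged l))
  | inr u => tpolyX R ^+ (next (tag u) - tag u) *: basis u - comb (@next_coef u)
  end.

Let in_rel (x : Free) : Prop :=
  exists d : B -> tpoly R, x = \sum_w d w *: rel w.

Let in_relD x y : in_rel x -> in_rel y -> in_rel (x + y).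
Proof.
move=> [c ->] [d ->]; exists (fun w => c w + d w); rewrite -big_split /=.
by apply: eq_bigr => w _; rewrite scalerDl.
Qed.

Let in_relZ p x : in_rel x -> in_rel (p *: x).
Proof.
move=> [c ->]; exists (fun w => p * c w); rewrite scaler_sumr.
by apply: eq_bigr => w _; rewrite scalerA.
Qed.

Let in_rel0 : in_rel 0.
Proof. by exists (fun=> 0); rewrite big1 // => w _; rewrite scale0r. Qed.

Let in_rel_sum (I : Type) (s : seq I) (P : pred I) (F : I -> Free) :
  (forall i, in_rel (F i)) -> in_rel (\sum_(i <- s | P i) F i).
Proof. by move=> KF; elim/big_ind: _ => //; exact: in_relD. Qed.

Let in_rel_rel w : in_rel (rel w).
Proof.
exists (fun w' => if w' == w then 1 else 0).
rewrite (bigD1 w) //= eqxx scale1r big1 ?addr0 // => w' /negPf->.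
by rewrite scale0r.
Qed.

Let combD (i : 'I_D.+1) (c d : 'I_(a i) -> R) :
  comb (fun k => c k + d k) = comb c + comb d.
Proof.
rewrite /comb -big_split /=.
by apply: eq_bigr => k _; rewrite tpolyCD scalerDl.
Qed.

Let combZ (i : 'I_D.+1) x (c : 'I_(a i) -> R) :
  comb (fun k => x * c k) = tpolyC x *: comb c.
Proof.
by rewrite /comb scaler_sumr; apply: eq_bigr => k _; rewrite tpolyCM scalerA.
Qed.

Let comb_sum (i : 'I_D.+1) (I : finType) (c : I -> 'I_(a i) -> R) :
  comb (fun k => \sum_j c j k) = \sum_j comb (c j).
Proof.
rewrite /comb exchange_big; apply: eq_bigr => k _ /=.
rewrite -scaler_suml; congr (_ *: _).
by apply: (big_morph _ (@tpolyCD R) (@tpolyC0 R)).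
Qed.

(** [p] is a vector of degree [n] above [x], in normal form modulo the relators:
    everything is pushed up to the component of degree [min(n, D)], from which
    the map to degree [n] is bijective. *)
Let lifts n (x : pm_comp M n) (p : Free) : Prop :=
  exists (i : 'I_D.+1) (c : 'I_(a i) -> R), [/\ i = minn n D :> nat,
    x = shift M i n (\sum_k c k *: g k) &
    in_rel (p - tpolyX R ^+ (n - i) *: comb c)].

Let lifts0 n : @lifts n 0 0.
Proof.
have i_lt : (minn n D < D.+1)%N by rewrite ltnS geq_minr.
exists (Ordinal i_lt), (fun=> 0); split; first by [].
  by rewrite big1 ?linear0 // => k _; rewrite scale0r.
rewrite /comb big1 ?scaler0 ?subr0 // => k _.
by rewrite tpolyC0 scale0r.
Qed.

Let liftsD n x y p q : @lifts n x p -> lifts y q -> lifts (x + y) (p + q).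
Proof.
move=> [i [c [i_n -> Kp]]] [j [d [j_n -> Kq]]].
have ij : j = i by apply: val_inj; rewrite /= i_n j_n.
subst j; exists i, (fun k => c k + d k); split; first exact: i_n.
  rewrite -linearD -big_split /=; congr (shift _ _ _ _).
  by apply: eq_bigr => k _; rewrite scalerDl.
rewrite combD [_ *: (comb c + _)]scalerDr opprD addrACA; exact: in_relD.
Qed.

Let liftsZ n z x p : @lifts n x p -> lifts (z *: x) (tpolyC z *: p).
Proof.
move=> [i [c [i_n -> Kp]]]; exists i, (fun k => z * c k).
split; first exact: i_n.
  rewrite -linearZ scaler_sumr /=; congr (shift _ _ _ _).
  by apply: eq_bigr => k _; rewrite scalerA.
by rewrite combZ scalerA -tpolyCX -scalerA -scalerBr; exact: in_relZ.
Qed.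

Let lifts_sum n (I : Type) (s : seq I) (x : I -> pm_comp M n) (p : I -> Free) :
  (forall i, lifts (x i) (p i)) ->
  lifts (\sum_(i <- s) x i) (\sum_(i <- s) p i).
Proof.
move=> xp; elim/big_rec2: _ => [|i y q _]; first exact: lifts0.
exact: liftsD.
Qed.

(** Normal forms survive multiplication by [t]: below degree [D] the relators
    attached to [next] rewrite them one degree higher. *)
Let liftsX n x p : @lifts n x p -> lifts (shift M n n.+1 x) (tpolyX R *: p).
Proof.
move=> [i [c [i_n -> Kp]]].
pose u k : A := Tagged (fun i : 'I_D.+1 => 'I_(a i)) (k : 'I_(a i)).
exists (next i), (fun l : 'I_(a (next i)) => \sum_k c k * @next_coef (u k) l).
have in_ : (i <= n)%N by rewrite i_n geq_minl.
have next_n : (next i <= n.+1)%N.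
  by rewrite next_val (leq_trans (geq_minl _ _)).
split.
- by rewrite next_val i_n -minnSS -minnA (minn_idPr (leqnSn D)).
- rewrite shift_comp // -(shift_comp _ (leq_next i) next_n).
  congr (shift _ _ _ _); rewrite linear_sum.
  under [RHS]eq_bigr do rewrite scaler_suml.
  rewrite exchange_big; apply: eq_bigr => k _ /=.
  rewrite linearZ /= (next_coefE (u k)) scaler_sumr.
  by apply: eq_bigr => l _; rewrite scalerA.
- rewrite -[tpolyX R *: p](subrK (tpolyX R *: (tpolyX R ^+ (n - i) *: comb c))).
  rewrite -addrA -scalerBr; apply: in_relD; first exact: in_relZ.
  have -> : tpolyX R *: (tpolyX R ^+ (n - i) *: comb c) =
      tpolyX R ^+ (n.+1 - next i) *: (tpolyX R ^+ (next i - i) *: comb c).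
    rewrite !scalerA -exprS -exprD; congr (_ ^+ _ *: _).
    by rewrite addnBA ?leq_next // subnK // subSn.
  rewrite -scalerBr; apply: in_relZ.
  rewrite comb_sum /comb [X in X - _]scaler_sumr -sumrB.
  apply: in_rel_sum => k.
  rewrite scalerA -tpolyCX -scalerA -[X in _ - X]/(comb _) combZ -scalerBr.
  by apply: in_relZ; exact: (in_rel_rel (inr (u k))).
Qed.

Let lifts_gen (u : A) s :
  lifts (shift M (tag u) (tag u + s) (g (tagged u))) (tpolyX R ^+ s *: basis u).
Proof.
elim: s => [|s IHs].
  rewrite addn0 shift_id scale1r.
  exists (tag u), (fun k => if k == tagged u then 1 else 0).
  have u_D : (tag u <= D)%N by rewrite -ltnS ltn_ord.
  split; first by rewrite (minn_idPl u_D).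
    rewrite shift_id (bigD1 (tagged u)) //= eqxx scale1r big1 ?addr0 // => k.
    by move=> /negPf->; rewrite scale0r.
  rewrite subnn scale1r /comb (bigD1 (tagged u)) //= eqxx tpolyC1 scale1r.
  rewrite big1 => [|k /negPf->]; last by rewrite tpolyC0 scale0r.
  by rewrite addr0; case: u {u_D} => i k; rewrite subrr.
rewrite addnS exprS -scalerA -(shift_comp _ (leq_addr s _) (leqnSn _)).
exact: liftsX.
Qed.

(** A normal form above 0 is a relation of the component of degree
    [min(n, D)], by injectivity of the map to degree [n]. *)
Let lifts_ker n p : @lifts n 0 p -> in_rel p.
Proof.
move=> [i [c [i_n x0 Kp]]].
have c0 : \sum_k c k *: g k = 0.
  by have [inj _] := shift_minn i_n; apply: inj.
have [_ _ relP] := comp_pres i; have [d dE] := relP _ c0.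
rewrite -[p](subrK (tpolyX R ^+ (n - i) *: comb c)).
apply: in_relD => //; apply: in_relZ.
have -> : c = fun k => \sum_l d l * r l k by apply: funext.
rewrite comb_sum; apply: in_rel_sum => l; rewrite combZ; apply: in_relZ.
exact: (in_rel_rel (inl (Tagged (fun i : 'I_D.+1 => 'I_(b i)) l))).
Qed.

Let eval (x : Free) : V := \sum_u (x u : tpoly R) *: gen u.

Let eval_linear : linear eval.
Proof.
move=> p x y; rewrite /eval scaler_sumr -big_split /=.
by apply: eq_bigr => u _; rewrite !ffunE scalerDl scalerA.
Qed.
HB.instance Definition _ :=
  GRing.isLinear.Build (tpoly R) Free V _ eval eval_linear.

Let eval_basis u : eval (basis u) = gen u.
Proof.
rewrite /eval (bigD1 u) //= ffunE eqxx scale1r big1 ?addr0 // => v /negPf vu.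
by rewrite ffunE vu scale0r.
Qed.

Let eval_comb (i : 'I_D.+1) (c : 'I_(a i) -> R) :
  eval (comb c) = @dsingle C i (\sum_k c k *: g k).
Proof.
rewrite /comb linear_sum (dsingle_sum (M := C)); apply: eq_bigr => k _.
by rewrite linearZ /= eval_basis dsingleZ.
Qed.

Let eval_rel w : eval (rel w) = 0.
Proof.
case: w => [[i l]|u] /=.
  have [_ rel0 _] := comp_pres i.
  by rewrite eval_comb rel0; exact: (@dsingle0 C).
rewrite linearB linearZ /= eval_basis eval_comb -next_coefE.
by rewrite dsingle_shift ?leq_next // subrr.
Qed.

Let gen_span (v : V) : exists c : A -> tpoly R, v = \sum_u c u *: gen u.
Proof.
suff [x <-] : exists x, eval x = v by exists x.
have [n v0] := dcoef_fin v.
have comp k (y : pm_comp M k) : exists x, eval x = @dsingle C k y.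
  have i_lt : (minn k D < D.+1)%N by rewrite ltnS geq_minr.
  pose i := Ordinal i_lt.
  have [z zE] : exists z, shift M i k z = y.
    by have [_] := shift_minn (erefl : i = minn k D :> nat); apply.
  have [/(_ z)[c cE] _ _] := comp_pres i.
  exists (tpolyX R ^+ (k - i) *: comb c); rewrite linearZ /= eval_comb -cE -zE.
  by rewrite dsingle_shift // geq_minl.
have /choice[x xE] (k : 'I_n) : exists x, eval x = @dsingle C k (dcoef v k).
  exact: comp.
exists (\sum_k x k); rewrite linear_sum (dsum_decomp v0).
by apply: eq_bigr => k _; exact: xE.
Qed.

(** Split [x] into its parts [t k] of degree [k], a basis vector counting with
    the degree of its generator; each part lifts a component of the value of
    [x], which is 0. *)
Let ker_in_rel (x : Free) : eval x = 0 -> in_rel x.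
Proof.
move=> x0; have [n xn] := dcoef_fin_family (fun u => x u : tpoly R).
pose t k : Free := \sum_(u : A)
  if (tag u <= k)%N then
    tpolyC (dcoef (x u : tpoly R) (k - tag u)) *:
      (tpolyX R ^+ (k - tag u) *: basis u)
  else 0.
have tE k u : t k u = if (tag u <= k)%N then
    tpolyC (dcoef (x u : tpoly R) (k - tag u)) * tpolyX R ^+ (k - tag u)
  else 0.
  rewrite sum_ffunE (bigD1 u) //= big1 ?addr0 => [|v /negPf vu].
    case: ifP => _; rewrite !ffunE // eqxx.
    exact: (congr1 (GRing.mul _) (mulr1 _)).
  by case: ifP => _; rewrite !ffunE // eq_sym vu !scaler0.
have -> : x = \sum_(k < n + D) t k.
  apply/ffunP => u; rewrite sum_ffunE; apply: dsumP => l.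
  rewrite dcoef_sum.
  have t_l k : dcoef (t k u) l =
      if k == (tag u + l)%N then dcoef (x u) l else 0.
    rewrite tE; case: leqP => [uk|ku]; last by rewrite ltn_eqF ?ltn_addr.
    rewrite tcoefCM tpolyXn_eq -{3}(subnKC uk) eqn_add2l eq_sym.
    by case: eqP => [->|_]; rewrite ?mulr1 ?mulr0.
  have [ul|ul] := ltnP (tag u + l) (n + D).
    rewrite (bigD1 (Ordinal ul)) // t_l eqxx big1 /= ?addr0 // => k kul.
    by rewrite t_l ifN.
  rewrite xn; last first.
    rewrite -(leq_add2r D) (leq_trans ul) // addnC leq_add2l.
    by rewrite -ltnS ltn_ord.
  rewrite big1 // => k _.
  by rewrite t_l ltn_eqF // (leq_trans (ltn_ord k)).
apply: in_rel_sum => k; apply: (@lifts_ker k).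
have -> : 0 = \sum_(u : A) if (tag u <= k)%N then
    dcoef (x u : tpoly R) (k - tag u) *: shift M (tag u) k (g (tagged u))
  else 0.
  rewrite -[LHS](dcoef0 C k) -x0 /eval (dcoef_sum (M := C)).
  by apply: eq_bigr => u _; exact: coefZ_dsingle.
apply: lifts_sum => u; case: ifP => [uk|_]; last exact: lifts0.
by apply: liftsZ; have := lifts_gen u (k - tag u); rewrite subnKC.
Qed.

Lemma graded_presentation : finitely_presented V.
Proof.
apply: (@presentation_fp _ _ _ _ gen (fun w u => rel w u)); split.
- exact: gen_span.
- exact: eval_rel.
- move=> c c0; have [|d dE] := @ker_in_rel [ffun u => c u].
    by rewrite -[RHS]c0; apply: eq_bigr => u _; rewrite ffunE.
  exists d => u; have -> : c u = [ffun u => c u] u by rewrite ffunE.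
  by rewrite dE sum_ffunE; apply: eq_bigr => w _; rewrite ffunE.
Qed.

End FromCompPresentations.

Lemma finitely_presented_type_graded_fp (R : pzRingType) (M : dapm R) :
  finitely_presented_type M ->
  finitely_presented (gr_carrier (graded_of_dapm M)).
Proof.
case=> [[D isoM] fpM].
have pres i := cid (fp_presentation (fpM i)).
have pres' i := cid (svalP (pres i)).
have pres'' i := cid (svalP (pres' i)).
have pres''' i := cid (svalP (pres'' i)).
apply: (graded_presentation (D := D) (fun i => svalP (pres''' i))).
move=> i j Di ij; have [h [hK Kh]] := isoM i j ij Di.
split=> [x|y]; last by exists (h y); rewrite (shiftE ij).
by rewrite (shiftE ij) => x0; rewrite -[x]hK x0 linear0.
Qed.

(** * The isomorphism of categories *)

Theorem theorem1 (R : pzRingType) :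
  cat_isomorphic (fp_graded_cat R) (fp_dapm_cat R).
Proof.
apply: cat_isomorphic_sym.
apply: (full_subcategory_isomorphic (F := graded_functor R)).
- exact: graded_functor_obj_bij.
- exact: graded_functor_bij.
- move=> M; split.
  + exact: finitely_presented_type_graded_fp.
  + exact: graded_fp_finitely_presented_type.
Qed.
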